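(* Let $m,n\ge0$ be integers. For every $q=x+yI$ with $x,y\in\mathbb R$ and $I\in\mathbb S$, $$H^Q_{m,n}(q,\overline q)=\left(\frac I2\right)^{m+n}m!\,n!\sum_{k=0}^{m}\sum_{j=0}^{n}\frac{(-1)^{n+k}I^{k+j}}{k!\,j!\,(m-k)!\,(n-j)!}\,H_{k+j}(x)\,H_{m+n-k-j}(y).$$
   Context: $\mathbb H$ is the algebra of real quaternions, $\mathbb S=\{I\in\mathbb H: I^2=-1\}$, $\overline q$ is the quaternionic conjugate. $H_n(x)=(-1)^n e^{x^2}\frac{d^n}{dx^n}(e^{-x^2})$ are the classical real Hermite polynomials. For integers $m,n\ge0$, $$H^Q_{m,n}(q,\overline q)=\sum_{k=0}^{\min(m,n)}(-1)^k k!\binom mk\binom nk q^{m-k}\overline q^{\,n-k}.$$ *)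

(* Defs.v *)
From HB Require Import structures.
From mathcomp Require Import all_boot all_order all_algebra.
From mathcomp Require Import ring.
From mathcomp Require Import all_classical all_reals all_analysis.
Set Implicit Arguments.
Unset Strict Implicit.
Unset Printing Implicit Defensive.
Import Order.TTheory GRing.Theory Num.Theory.
Import numFieldNormedType.Exports.
Local Open Scope classical_set_scope.
Local Open Scope ring_scope.

(* [Quat a b c d] is a + b i + c j + d k. *)
Record quat (R : Type) := Quat { q_re : R; q_i : R; q_j : R; q_k : R }.

Definition tuple_of_quat (R : Type) (p : quat R) :=
  (q_re p, q_i p, q_j p, q_k p).
Definition quat_of_tuple (R : Type) (t : R * R * R * R) :=
  let: (a, b, c, d) := t in Quat a b c d.
Lemma tuple_of_quatK (R : Type) :
  cancel (@tuple_of_quat R) (@quat_of_tuple R).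
Proof. by case. Qed.

HB.instance Definition _ (R : eqType) :=
  Equality.copy (quat R) (can_type (@tuple_of_quatK R)).
HB.instance Definition _ (R : choiceType) :=
  Choice.copy (quat R) (can_type (@tuple_of_quatK R)).

Section QuatAlgebra.
Variable R : comNzRingType.
Implicit Types (a : R) (p q r : quat R).

Definition quat_zero : quat R := Quat 0 0 0 0.
Definition quat_one : quat R := Quat 1 0 0 0.
Definition quat_opp p := Quat (- q_re p) (- q_i p) (- q_j p) (- q_k p).
Definition quat_add p q :=
  Quat (q_re p + q_re q) (q_i p + q_i q) (q_j p + q_j q) (q_k p + q_k q).
Definition quat_mul p q :=
  Quat (q_re p * q_re q - q_i p * q_i q - q_j p * q_j q - q_k p * q_k q)
       (q_re p * q_i q + q_i p * q_re q + q_j p * q_k q - q_k p * q_j q)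
       (q_re p * q_j q - q_i p * q_k q + q_j p * q_re q + q_k p * q_i q)
       (q_re p * q_k q + q_i p * q_j q - q_j p * q_i q + q_k p * q_re q).
Definition quat_scale a p :=
  Quat (a * q_re p) (a * q_i p) (a * q_j p) (a * q_k p).
Definition quat_conj p := Quat (q_re p) (- q_i p) (- q_j p) (- q_k p).

Lemma quatP p q : q_re p = q_re q -> q_i p = q_i q -> q_j p = q_j q ->
  q_k p = q_k q -> p = q.
Proof. by case: p q => [a b c d] [a' b' c' d'] /= -> -> -> ->. Qed.

Ltac quat_ring := repeat intro; apply: quatP => /=; ring.

Lemma quat_addA : associative quat_add. Proof. quat_ring. Qed.
Lemma quat_addC : commutative quat_add. Proof. quat_ring. Qed.
Lemma quat_add0 : left_id quat_zero quat_add. Proof. quat_ring. Qed.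
Lemma quat_addN : left_inverse quat_zero quat_opp quat_add.
Proof. quat_ring. Qed.

HB.instance Definition _ :=
  GRing.isZmodule.Build (quat R) quat_addA quat_addC quat_add0 quat_addN.

Lemma quat_mulA : associative quat_mul. Proof. quat_ring. Qed.
Lemma quat_mul1 : left_id quat_one quat_mul. Proof. quat_ring. Qed.
Lemma quat_mulr1 : right_id quat_one quat_mul. Proof. quat_ring. Qed.
Lemma quat_mulDl : left_distributive quat_mul quat_add. Proof. quat_ring. Qed.
Lemma quat_mulDr : right_distributive quat_mul quat_add. Proof. quat_ring. Qed.
Lemma quat_one_neq0 : quat_one != 0.
Proof. by apply/eqP => -[] /eqP; rewrite oner_eq0. Qed.

HB.instance Definition _ := GRing.Zmodule_isNzRing.Build (quat R)
  quat_mulA quat_mul1 quat_mulr1 quat_mulDl quat_mulDr quat_one_neq0.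

Lemma quat_scaleA a b p :
  quat_scale a (quat_scale b p) = quat_scale (a * b) p.
Proof. quat_ring. Qed.
Lemma quat_scale1 : left_id 1 quat_scale. Proof. quat_ring. Qed.
Lemma quat_scaleDr : right_distributive quat_scale +%R. Proof. quat_ring. Qed.
Lemma quat_scaleDl p : {morph quat_scale^~ p : a b / a + b}.
Proof. quat_ring. Qed.

HB.instance Definition _ := GRing.Zmodule_isLmodule.Build R (quat R)
  quat_scaleA quat_scale1 quat_scaleDr quat_scaleDl.

Lemma quat_scaleAl a p q : a *: (p * q) = (a *: p) * q.
Proof. quat_ring. Qed.

HB.instance Definition _ :=
  GRing.Lmodule_isLalgebra.Build R (quat R) quat_scaleAl.

Lemma quat_scaleAr a p q : a *: (p * q) = p * (a *: q).
Proof. quat_ring. Qed.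

HB.instance Definition _ :=
  GRing.Lalgebra_isAlgebra.Build R (quat R) quat_scaleAr.

End QuatAlgebra.

Definition imag_sphere (R : realType) : set (quat R) := [set I | I ^+ 2 = -1].

Definition hermite (R : realType) (n : nat) (x : R) : R :=
  (-1) ^+ n * expR (x ^+ 2) * derive1n n (fun t : R => expR (- t ^+ 2)) x.

(* The value H^Q_{m,n}(q, conj q), as a function of q. *)
Definition hermiteQ (R : realType) (m n : nat) (q : quat R) : quat R :=
  \sum_(k < (minn m n).+1)
    ((-1) ^+ k * (k`! * 'C(m, k) * 'C(n, k))%:R : R) *:
      (q ^+ (m - k) * quat_conj q ^+ (n - k)).

(* Main.v *)
From HB Require Import structures.
Require Import Defs.
From mathcomp Require Import all_boot all_order all_algebra.
From mathcomp Require Import all_classical all_reals all_analysis.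
From mathcomp Require Import zify ring complex.

(** The three-term recurrence of the real Hermite polynomials says that the
    linear functional sending [alpha ^ k] to [H_k(x)] turns multiplication by
    [alpha] into the operator [2 x - 2 d_alpha] ([umbral_mulX]).  In two
    variables, let [L] send [alpha ^ k beta ^ l] to [H_k(x) H_l(y)]; then
      [L ((alpha + c beta) p) = 2 (x + c y) L p - 2 L ((d_alpha + c d_beta) p)]
    for every constant [c] ([umbral2_mul_linear]).

    Let [i ^ 2 = -1], [u = alpha + i beta] and [v = alpha - i beta].  The
    derivation [d_alpha + i d_beta] kills [u] and sends [v] to [2], while
    [d_alpha - i d_beta] kills [v], so [F m n = L (u ^ m v ^ n) / 2 ^ (m + n)]
    obeys
      [F (m + 1) n = z F m n - n F m (n - 1)],   [F 0 n = w ^ n],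
    with [z = x + i y] and [w = x - i y].  These relations also determine the
    complex Hermite polynomials [complex_hermite] ([complex_hermiteS]), hence
    [L (u ^ m v ^ n) = 2 ^ (m + n) H_{m,n}(z, w)] ([umbral2_complex_hermite]).
    Expanding [u ^ m] and [v ^ n] by the binomial theorem ([umbral2_expansion])
    gives the double sum.

    All this takes place in a commutative ring.  It reaches the quaternions
    through the slice of [I], the ring morphism [a + b i |-> a + b I] from the
    complex numbers; it turns complex conjugation into quaternionic conjugation
    because a square root of [-1] has no real part ([sqrt_opp1_conj]). *)

Set Implicit Arguments.
Unset Strict Implicit.
Unset Printing Implicit Defensive.
Import Order.TTheory GRing.Theory Num.Theory.
Import numFieldNormedType.Exports.
Local Open Scope classical_set_scope.
Local Open Scope ring_scope.

(** * Umbral evaluation *)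

(** The linear functional sending ['X^k] to [a k]. *)
Definition umbral (A : comNzRingType) (a : nat -> A) (p : {poly A}) : A :=
  \sum_(k < size p) p`_k * a k.

(** The three-term recurrence of the Hermite polynomials at the point [x]; the
    value of [a] at [n.-1] for [n = 0] is multiplied by [0]. *)
Definition hermite_rec (A : comNzRingType) (x : A) (a : nat -> A) : Prop :=
  forall n, a n.+1 = 2 * x * a n - (2 * n)%:R * a n.-1.

Lemma umbralE (A : comNzRingType) (a : nat -> A) N (p : {poly A}) :
  (size p <= N)%N -> umbral a p = \sum_(k < N) p`_k * a k.
Proof.
move=> pN; rewrite /umbral (big_ord_widen _ (fun k => p`_k * a k) pN).
rewrite big_mkcond; apply: eq_bigr => k _; case: ltnP => // pk.
by rewrite nth_default ?mul0r.
Qed.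

Lemma umbralD (A : comNzRingType) (a : nat -> A) :
  {morph umbral a : p q / p + q}.
Proof.
move=> p q; pose N := maxn (size p) (size q).
rewrite (umbralE a (N := N) (p := (p + q))) ?size_polyD//.
rewrite (umbralE a (N := N) (p := p)) ?leq_maxl//.
rewrite (umbralE a (N := N) (p := q)) ?leq_maxr//.
by rewrite -big_split; apply: eq_bigr => k _; rewrite coefD mulrDl.
Qed.

Lemma umbralZ (A : comNzRingType) (a : nat -> A) c (p : {poly A}) :
  umbral a (c *: p) = c * umbral a p.
Proof.
rewrite (umbralE a (N := size p)) ?size_scale_leq// mulr_sumr.
by apply: eq_bigr => k _; rewrite coefZ mulrA.
Qed.

Lemma umbralXn (A : comNzRingType) (a : nat -> A) n : umbral a 'X^n = a n.
Proof.
rewrite /umbral size_polyXn big_ord_recr/= coefXn eqxx mul1r big1 ?add0r//.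
by move=> k _; rewrite coefXn (ltn_eqF (ltn_ord k)) mul0r.
Qed.

(** The three-term recurrence says this on the monomials ['X^n], since
    [n * a n.-1] is the value at the derivative of ['X^n]. *)
Lemma umbral_mulX (A : comNzRingType) (x : A) (a : nat -> A) (p : {poly A}) :
  hermite_rec x a ->
  umbral a ('X * p) = 2 * x * umbral a p - 2 * umbral a p^`().
Proof.
move=> ha; rewrite (umbralE a (N := (size p).+1)); last first.
  by rewrite mulrC (leq_trans (size_polyMleq _ _))// size_polyX addn2.
rewrite (umbralE a (leqnn (size p)))//.
rewrite (umbralE a (N := (size p).-1)); last exact: size_poly.
transitivity (\sum_(k < size p) p`_k * a k.+1).
  rewrite big_ord_recl coefXM mul0r add0r.
  by apply: eq_bigr => k _; rewrite coefXM.
transitivity (2 * x * (\sum_(k < size p) p`_k * a k)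
   - 2 * (\sum_(k < size p) p`_k *+ k * a k.-1)).
  rewrite !mulr_sumr -sumrB; apply: eq_bigr => k _.
  by rewrite ha natrM -mulr_natl; ring.
congr (_ - 2 * _); case: (size p) => [|s]; first by rewrite !big_ord0.
rewrite big_ord_recl mulr0n mul0r add0r; apply: eq_bigr => k _.
by rewrite coef_deriv.
Qed.

(** * Umbral evaluation in two variables *)

(** The functional sending the monomial [alpha ^ k * beta ^ l] to [a k * b l].
    In [{poly {poly A}}], [alpha] is the inner variable ['X%:P] and [beta] the
    outer variable ['X]. *)
Definition umbral2 (A : comNzRingType) (a b : nat -> A) (p : {poly {poly A}})
    : A :=
  umbral a (umbral (fun k => (b k)%:P) p).

(** The derivation [d_alpha + c d_beta]. *)
Definition dirderiv (A : comNzRingType) (c : A) (p : {poly {poly A}}) :=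
  map_poly (fun q : {poly A} => q^`()) p + c%:P%:P * p^`().

Lemma umbral2D (A : comNzRingType) (a b : nat -> A) :
  {morph umbral2 a b : p q / p + q}.
Proof. by move=> p q; rewrite /umbral2 !umbralD. Qed.

Lemma umbral2Z (A : comNzRingType) (a b : nat -> A) (c : A)
    (p : {poly {poly A}}) :
  umbral2 a b (c%:P%:P * p) = c * umbral2 a b p.
Proof. by rewrite /umbral2 mul_polyC umbralZ mul_polyC umbralZ. Qed.

Lemma umbral2_sum (A : comNzRingType) (a b : nat -> A) (J : Type) (r : seq J)
    (F : J -> {poly {poly A}}) :
  umbral2 a b (\sum_(j <- r) F j) = \sum_(j <- r) umbral2 a b (F j).
Proof.
apply: (big_morph _ (umbral2D a b)).
by rewrite -[0](mul0r 0) -!polyC0 umbral2Z mul0r.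
Qed.

Lemma umbral2_monomial (A : comNzRingType) (a b : nat -> A) k l :
  umbral2 a b (('X ^+ k)%:P * 'X ^+ l) = a k * b l.
Proof.
rewrite /umbral2 mul_polyC umbralZ umbralXn mulrC mul_polyC umbralZ umbralXn.
by rewrite mulrC.
Qed.

(** The values given to the powers of [beta] are constants for [alpha]. *)
Lemma umbral_map_deriv (A : comNzRingType) (b : nat -> A)
    (p : {poly {poly A}}) :
  umbral (fun k => (b k)%:P) (map_poly (fun q : {poly A} => q^`()) p) =
  (umbral (fun k => (b k)%:P) p)^`().
Proof.
rewrite (umbralE _ (N := size p)); last exact: size_poly.
rewrite /umbral raddf_sum; apply: eq_bigr => k _.
by rewrite coef_map_id0 ?deriv0// mulrC mul_polyC -derivZ mulrC mul_polyC.
Qed.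

(** Multiplication by a linear form becomes, under the functional, a first-order
    operator: [umbral_mulX] in each of the two variables. *)
Lemma umbral2_mul_linear (A : comNzRingType) (x y c : A) (a b : nat -> A)
    (p : {poly {poly A}}) :
  hermite_rec x a -> hermite_rec y b ->
  umbral2 a b (('X%:P + c%:P%:P * 'X) * p) =
  2 * (x + c * y) * umbral2 a b p - 2 * umbral2 a b (dirderiv c p).
Proof.
move=> ha hb.
have hbP : hermite_rec y%:P (fun k => (b k)%:P).
  by move=> n; rewrite hb rmorphB !rmorphM !rmorph_nat.
rewrite mulrDl -mulrA !umbral2D !umbral2Z.
have -> : umbral2 a b ('X%:P * p) = 2 * x * umbral2 a b p
    - 2 * umbral2 a b (map_poly (fun q : {poly A} => q^`()) p).
  by rewrite /umbral2 mul_polyC umbralZ (umbral_mulX _ ha) umbral_map_deriv.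
have -> : umbral2 a b ('X * p) = 2 * y * umbral2 a b p
    - 2 * umbral2 a b p^`().
  rewrite /umbral2 (umbral_mulX _ hbP).
  set P := umbral _ p; set Q := umbral _ p^`().
  have -> : 2 * y%:P * P - 2 * Q = (2 * y) *: P + (- 2) *: Q.
    by rewrite -!mul_polyC !rmorphM rmorphN !rmorph_nat mulNr.
  by rewrite umbralD !umbralZ mulNr.
ring.
Qed.

Lemma dirderivM (A : comNzRingType) (c : A)
    (p q : {poly {poly A}}) :
  dirderiv c (p * q) = dirderiv c p * q + p * dirderiv c q.
Proof.
suff mapM : map_poly (fun q : {poly A} => q^`()) (p * q) =
    map_poly (fun q : {poly A} => q^`()) p * q +
    p * map_poly (fun q : {poly A} => q^`()) q.
  by rewrite /dirderiv mapM derivM; ring.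
apply/polyP => k; rewrite coefD coef_map_id0 ?deriv0// !coefM raddf_sum.
rewrite -big_split; apply: eq_bigr => l _.
by rewrite /= derivM !coef_map_id0 ?deriv0.
Qed.

Lemma dirderivXn (A : comNzRingType) (c : A)
    (p : {poly {poly A}}) n :
  dirderiv c (p ^+ n) = n%:R * p ^+ n.-1 * dirderiv c p.
Proof.
elim: n => [|n IH].
  rewrite /dirderiv mul0r mul0r expr0 -[1]/(1%:P) derivC mulr0 addr0.
  by rewrite map_polyC/= -[1]/(1%:P) derivC polyC0.
rewrite exprS dirderivM IH -natr1.
by case: n {IH} => [|n] /=; rewrite ?expr0 ?exprS; ring.
Qed.

Lemma dirderiv_linear (A : comNzRingType) (c d : A) :
  dirderiv c ('X%:P + d%:P%:P * 'X) = (1 + c * d)%:P%:P.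
Proof.
have -> : dirderiv c ('X%:P + d%:P%:P * 'X) = 1 + c%:P%:P * d%:P%:P.
  rewrite /dirderiv derivD derivC mul_polyC derivZ derivX add0r.
  rewrite alg_polyC; congr (_ + _).
  apply/polyP => k; rewrite coef_map_id0 ?deriv0// coefD coefZ coefX !coefC.
  case: k => [|[|k]]/=; rewrite ?mulr0 ?addr0 ?add0r ?derivX ?deriv0// ?mulr1.
  by rewrite derivC.
by rewrite !rmorphD !rmorphM.
Qed.

(** * Complex Hermite polynomials *)

(** The variable [w], the conjugate of [z] in the classical setting, is
    independent here, so that no conjugation is needed on the ring. *)
Definition complex_hermite (A : comNzRingType) (m n : nat) (z w : A) : A :=
  \sum_(k < (minn m n).+1)
    (-1) ^+ k * (k`! * 'C(m, k) * 'C(n, k))%:R * (z ^+ (m - k) * w ^+ (n - k)).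

(** The binomial coefficients vanish beyond [minn m n]: sums with different [m]
    and [n] can be given a common range. *)
Lemma complex_hermiteE (A : comNzRingType) (m n N : nat) (z w : A) :
  (minn m n < N)%N ->
  complex_hermite m n z w = \sum_(k < N)
    (-1) ^+ k * (k`! * 'C(m, k) * 'C(n, k))%:R * (z ^+ (m - k) * w ^+ (n - k)).
Proof.
move=> N1; rewrite /complex_hermite (big_ord_widen N (fun k => (-1) ^+ k *
  (k`! * 'C(m, k) * 'C(n, k))%:R * (z ^+ (m - k) * w ^+ (n - k))) N1).
rewrite big_mkcond; apply: eq_bigr => k _; case: ltnP => //.
rewrite gtn_min => km.
have -> : (k`! * 'C(m, k) * 'C(n, k) = 0)%N; last by rewrite mulr0 mul0r.
by case/orP: km => /bin_small ->; rewrite ?muln0.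
Qed.

Lemma complex_hermite0 (A : comNzRingType) (n : nat) (z w : A) :
  complex_hermite 0 n z w = w ^+ n.
Proof.
by rewrite /complex_hermite min0n big_ord1 !expr0 !bin0 subn0 !mul1r.
Qed.

(** Pascal's rule on ['C(m.+1, k.+1)] splits the coefficient in two; the
    absorption identity [k.+1 * 'C(n.+1, k.+1) = n.+1 * 'C(n, k)] turns the second
    part into a coefficient with upper indices [m] and [n]. *)
Lemma complex_hermiteS (A : comNzRingType) (m n : nat) (z w : A) :
  complex_hermite m.+1 n z w =
  z * complex_hermite m n z w - n%:R * complex_hermite m n.-1 z w.
Proof.
case: n => [|n].
  rewrite mul0r subr0 /complex_hermite !minn0 !big_ord1 !bin0 !subn0 exprS.
  by rewrite !expr0 !mulr1 !mul1r.
have lt_min k l : (minn k l < l.+1)%N by rewrite ltnS geq_minr.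
rewrite !(complex_hermiteE _ _ (lt_min _ _)).
rewrite [in LHS]big_ord_recl [in X in z * X]big_ord_recl.
rewrite [in RHS]mulrDr -addrA; congr (_ + _).
  by rewrite !bin0 !subn0 exprS; ring.
rewrite !mulr_sumr -sumrB; apply: eq_bigr => k _.
rewrite !lift0 !subSS binS.
have -> : (k.+1`! * ('C(m, k.+1) + 'C(m, k)) * 'C(n.+1, k.+1) =
    k.+1`! * 'C(m, k.+1) * 'C(n.+1, k.+1) + n.+1 * (k`! * 'C(m, k) * 'C(n, k)))%N.
  have bin_diag := mul_bin_diag n.+1 k; rewrite /= in bin_diag.
  transitivity (k.+1`! * 'C(m, k.+1) * 'C(n.+1, k.+1) +
      k`! * 'C(m, k) * (n.+1 * 'C(n, k)))%N; last by lia.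
  by rewrite bin_diag factS; lia.
rewrite natrD (natrM _ n.+1); set P := (_ * _ * _)%:R; set Q := (_ * _ * _)%:R.
(* When [k >= m] the subtraction is truncated, but then [P = 0]. *)
have zP : P * z ^+ (m - k) = z * (P * z ^+ (m - k.+1)).
  case: (ltnP k m) => km; last first.
    by rewrite /P bin_small// muln0 mul0n !mul0r mulr0.
  by rewrite -(subnSK km) exprS; ring.
transitivity ((-1) ^+ k.+1 * (P * z ^+ (m - k)) * w ^+ (n - k) -
    n.+1%:R * ((-1) ^+ k * Q * (z ^+ (m - k) * w ^+ (n - k)))).
  by rewrite exprS; ring.
by rewrite zP; ring.
Qed.


(** * The umbral formula *)

(** Both sides satisfy the recurrence of [complex_hermiteS] in [m], because the
    derivation along [i] kills [u] and sends [v] to [1 - i ^ 2 = 2]; for [m = 0]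
    the derivation along [- i] kills [v], and [v] acts as multiplication by
    [2 w]. *)
Lemma umbral2_complex_hermite (A : comNzRingType) (i x y : A)
    (a b : nat -> A) m n :
  i ^+ 2 = -1 -> hermite_rec x a -> hermite_rec y b -> a 0 = 1 -> b 0 = 1 ->
  umbral2 a b (('X%:P + i%:P%:P * 'X) ^+ m * ('X%:P + (- i)%:P%:P * 'X) ^+ n) =
  2 ^+ (m + n) * complex_hermite m n (x + i * y) (x - i * y).
Proof.
move=> i2 ha hb a0 b0; set u := 'X%:P + i%:P%:P * 'X; set v := 'X%:P + _.
elim: m n => [|m IHm] n.
  rewrite expr0 mul1r add0n complex_hermite0; elim: n => [|n IHn].
    have := umbral2_monomial a b 0 0; rewrite !expr0 a0 b0 mulr1 mulr1 => <-.
    by rewrite polyC1.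
  rewrite exprS /v (umbral2_mul_linear _ _ ha hb) -/v IHn.
  have -> : dirderiv (- i) (v ^+ n) = 0%:P%:P * 1.
    rewrite dirderivXn dirderiv_linear mulrNN -expr2 i2 subrr.
    by rewrite !polyC0 mul0r mulr0.
  by rewrite umbral2Z !exprS; ring.
rewrite exprS -mulrA {1}/u (umbral2_mul_linear _ _ ha hb) IHm complex_hermiteS.
have -> : dirderiv i (u ^+ m * v ^+ n) =
    (2 * n%:R)%:P%:P * (u ^+ m * v ^+ n.-1).
  rewrite dirderivM !dirderivXn !dirderiv_linear mulrN -expr2 i2 subrr opprK.
  by rewrite !polyC0 !rmorphM !rmorph_nat; ring.
rewrite umbral2Z IHm; case: n => [|n]; first by rewrite !addn0 exprS; ring.
by rewrite !(addnS, addSn) !exprS; ring.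
Qed.

Lemma umbral2_expansion (A : comNzRingType) (c d : A) (a b : nat -> A) m n :
  umbral2 a b (('X%:P + c%:P%:P * 'X) ^+ m * ('X%:P + d%:P%:P * 'X) ^+ n) =
  \sum_(k < m.+1) \sum_(j < n.+1) ('C(m, k) * 'C(n, j))%:R *
    (c ^+ (m - k) * d ^+ (n - j)) * (a (k + j)%N * b (m + n - k - j)%N).
Proof.
rewrite !(addrC 'X%:P) !exprDn big_distrlr umbral2_sum; apply: eq_bigr => k _.
rewrite umbral2_sum; apply: eq_bigr => j _.
have -> : (m + n - k - j = (m - k) + (n - j))%N.
  by have := ltn_ord k; have := ltn_ord j; lia.
rewrite -(umbral2_monomial a b) -(umbral2Z a b); congr (umbral2 a b _).
have -> : (('C(m, k) * 'C(n, j))%:R * (c ^+ (m - k) * d ^+ (n - j)))%:P%:P =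
    'C(m, k)%:R * 'C(n, j)%:R * (c%:P%:P ^+ (m - k) * d%:P%:P ^+ (n - j)).
  by rewrite natrM !polyCM !polyC_exp !polyC_natr.
rewrite polyC_exp (exprD _ k) (exprD _ (m - k)).
rewrite -[_ *+ 'C(m, k)]mulr_natl -[_ *+ 'C(n, j)]mulr_natl /=.
rewrite (exprMn (m - k)) (exprMn (n - j)).
move: 'C(m, k)%:R 'C(n, j)%:R (c%:P%:P ^+ _) (d%:P%:P ^+ _) => r s C D.
move: ('X%:P ^+ k) ('X%:P ^+ j) ('X ^+ (m - k)) ('X ^+ (n - j)) => U V X Y.
ring.
Qed.

(** * Real Hermite polynomials *)

(** The polynomial [P] for which the [n]-th derivative of [exp (- t ^ 2)] is
    [P t * exp (- t ^ 2)]; up to the sign [(-1) ^ n] it is the Hermite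
    polynomial. *)
Fixpoint gauss_poly (A : comNzRingType) (n : nat) : {poly A} :=
  if n is k.+1 then (gauss_poly A k)^`() - 2 * 'X * gauss_poly A k else 1.

Lemma gauss_polyS (A : comNzRingType) n :
  gauss_poly A n.+1 = (gauss_poly A n)^`() - 2 * 'X * gauss_poly A n.
Proof. by []. Qed.

Lemma gauss_polyS_horner (A : comNzRingType) n (t : A) :
  (gauss_poly A n.+1).[t] =
  (gauss_poly A n)^`().[t] - 2 * t * (gauss_poly A n).[t].
Proof.
rewrite gauss_polyS hornerD hornerN -mulrA mulr_natl hornerMn.
by rewrite (mulrC 'X) hornerMX -mulr_natl; ring.
Qed.

(** The Appell property of the Hermite polynomials, which turns the first-order
    recurrence of [gauss_poly] into the three-term one. *)
Lemma deriv_gauss_poly (A : comNzRingType) n :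
  (gauss_poly A n)^`()%R = - (2 * n)%:R * gauss_poly A n.-1.
Proof.
have deriv_natM k (p : {poly A}) : (k%:R * p)^`()%R = k%:R * p^`()%R.
  by rewrite !mulr_natl derivMn.
elim: n => [|n IH]; first by rewrite /= derivC oppr0 mul0r.
rewrite gauss_polyS derivB -mulrA deriv_natM derivM derivX mul1r IH.
rewrite mulNr derivN deriv_natM succnK.
case: n {IH} => [|n]; first by rewrite !mul0r !oppr0 mulr0 addr0 sub0r mulNr.
by rewrite succnK !gauss_polyS; ring.
Qed.

Lemma derive1n_gauss (R : realType) n :
  derive1n n (fun t : R => expR (- t ^+ 2)) =
  (fun t => (gauss_poly R n).[t] * expR (- t ^+ 2)).
Proof.
elim: n => [|n IH]; first by apply/funext => t; rewrite /= hornerC mul1r.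
rewrite derive1nS IH; apply/funext => t; rewrite derive1E.
have dgauss : is_derive t 1 (fun u : R => expR (- u ^+ 2))
    (expR (- t ^+ 2) * - (2 * t)).
  apply: (@is_derive1_comp R expR (fun u : R => - u ^+ 2)).
  have -> : (fun u : R => - u ^+ 2) = horner (- 'X^2 : {poly R}).
    by apply/funext => u; rewrite hornerN hornerXn.
  apply: is_derive_eq; rewrite derivN derivXn hornerN hornerMn hornerXn.
  by rewrite mulr_natl expr1.
have dmul := is_deriveM (is_derive_poly (gauss_poly R n) t) dgauss.
rewrite (@derive_val _ _ _ _ _ _ _ dmul).
rewrite gauss_polyS_horner /GRing.scale/=; ring.
Qed.

Lemma hermiteE (R : realType) n (x : R) :
  hermite n x = (-1) ^+ n * (gauss_poly R n).[x].
Proof.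
rewrite /hermite derive1n_gauss -mulrA [expR _ * _]mulrCA.
by rewrite -expRD subrr expR0 mulr1.
Qed.

Lemma hermite0 (R : realType) (x : R) : hermite 0 x = 1.
Proof. by rewrite hermiteE expr0 mul1r hornerC. Qed.

Lemma hermite_recP (R : realType) (x : R) :
  hermite_rec x (fun n => hermite n x).
Proof.
move=> n; rewrite !hermiteE gauss_polyS_horner exprS.
have -> : (gauss_poly R n)^`().[x] = - (2 * n)%:R * (gauss_poly R n.-1).[x].
  by rewrite deriv_gauss_poly mulNr mulr_natl hornerN hornerMn -mulr_natl mulNr.
by case: n => [|n]; rewrite ?succnK ?exprS; ring.
Qed.

(** * The slice of an imaginary unit *)

(** The proof [hI] is an argument so that it determines the morphism structure
    attached to the function. *)
Definition slice (R : realType) (I : quat R) (hI : I ^+ 2 = -1) (z : R[i]) :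
    quat R :=
  (complex.Re z)%:A + complex.Im z *: I.

Fact slice_zmod (R : realType) (I : quat R) (hI : I ^+ 2 = -1) :
  zmod_morphism (slice hI).
Proof. by case=> [a b] [c d]; rewrite /slice/= !scalerBl opprD addrACA. Qed.

Fact slice_monoid (R : realType) (I : quat R) (hI : I ^+ 2 = -1) :
  monoid_morphism (slice hI).
Proof.
split; first by rewrite /slice/= scale0r addr0 scale1r.
case=> [a b] [c d]; rewrite /slice/= mulrDl !mulrDr -!scalerAl -!scalerAr.
rewrite !mul1r mulr1 -expr2 hI !scalerA scalerN scalerBl scalerDl -!addrA.
by congr (_ + _); rewrite addrC -!addrA; congr (_ + _).
Qed.

HB.instance Definition _ (R : realType) (I : quat R) (hI : I ^+ 2 = -1) :=
  GRing.isZmodMorphism.Build R[i] (quat R) (slice hI) (slice_zmod hI).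
HB.instance Definition _ (R : realType) (I : quat R) (hI : I ^+ 2 = -1) :=
  GRing.isMonoidMorphism.Build R[i] (quat R) (slice hI) (slice_monoid hI).

Lemma slice_real (R : realType) (I : quat R) (hI : I ^+ 2 = -1) (a : R) :
  slice hI a%:C%C = a%:A.
Proof. by rewrite /slice/= scale0r addr0. Qed.

Lemma sliceZ (R : realType) (I : quat R) (hI : I ^+ 2 = -1) (a : R) z :
  slice hI (a%:C%C * z) = a *: slice hI z.
Proof. by rewrite rmorphM /= slice_real -scalerAl mul1r. Qed.

Lemma slice_i (R : realType) (I : quat R) (hI : I ^+ 2 = -1) :
  slice hI (Complex 0 1) = I.
Proof. by rewrite /slice/= scale0r add0r scale1r. Qed.

(** A square root of [-1] is purely imaginary: if its real part [a] were nonzero,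
    the imaginary parts [2 a b], [2 a c], [2 a d] of the square would force
    [b = c = d = 0], and then [a ^ 2 = -1]. *)
Lemma sqrt_opp1_conj (R : realDomainType) (I : quat R) :
  I ^+ 2 = -1 -> quat_conj I = - I.
Proof.
case: I => a b c d; rewrite expr2 => -[re_eq i_eq j_eq k_eq].
suff a0 : a = 0 by apply: quatP; rewrite /= ?a0 ?oppr0.
have [//|a_neq0] := eqVneq a 0.
have zero e : 2 * a * e = 0 -> e = 0.
  by move/eqP; rewrite mulf_eq0 mulf_eq0 pnatr_eq0 (negPf a_neq0) => /eqP.
have b0 : b = 0 by apply: zero; rewrite -[RHS]oppr0 -i_eq /=; ring.
have c0 : c = 0 by apply: zero; rewrite -[RHS]oppr0 -j_eq /=; ring.
have d0 : d = 0 by apply: zero; rewrite -[RHS]oppr0 -k_eq /=; ring.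
move: re_eq => /= /eqP; rewrite b0 c0 d0 !mul0r !subr0 -expr2 => /eqP a2.
by have := sqr_ge0 a; rewrite a2 ler0N1.
Qed.

Lemma hermiteQ_slice (R : realType) (I : quat R) (hI : I ^+ 2 = -1) m n
    (x y : R) :
  hermiteQ m n (x%:A + y *: I) =
  slice hI (complex_hermite m n (x%:C%C + Complex 0 1 * y%:C%C)
                                (x%:C%C - Complex 0 1 * y%:C%C)).
Proof.
have conjE : quat_conj (x%:A + y *: I) = x%:A + y *: quat_conj I.
  by apply: quatP => /=; ring.
rewrite /hermiteQ conjE (sqrt_opp1_conj hI) rmorph_sum /=; apply: eq_bigr => k _.
have real_coef (c : nat) : (-1) ^+ k * c%:R = ((-1) ^+ k * c%:R)%:C%C :> R[i].
  by rewrite rmorphM rmorphXn rmorphN1 rmorph_nat.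
rewrite real_coef sliceZ; congr (_ *: _).
rewrite rmorphM !rmorphXn rmorphB rmorphD /= rmorphM /= !slice_real slice_i.
by rewrite -scalerAr mulr1 scalerN.
Qed.

(** * The expansion for quaternions *)

Lemma sqr_imag (R : realType) : (Complex 0 1 : R[i]) ^+ 2 = -1.
Proof.
rewrite expr2; apply/eqP; rewrite eq_complex /=.
by apply/andP; split; apply/eqP; ring.
Qed.

(** Since [i ^ -1 = - i], a truncated difference of exponents can be replaced by
    their sum. *)
Lemma expr_subn_sqrtN1 (A : comNzRingType) (i : A) m k :
  i ^+ 2 = -1 -> (k <= m)%N -> i ^+ (m - k) = (-1) ^+ k * i ^+ (m + k).
Proof.
move=> i2 km; rewrite -{2}(subnK km) !exprD -mulrA -exprD addnn -mul2n exprM i2.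
by rewrite mulrCA -exprD addnn -mul2n exprM sqrrN expr1n expr1n mulr1.
Qed.

Theorem lemma3p1 (R : realType) (m n : nat) (x y : R) (I : quat R)
    (hI : imag_sphere I) :
  hermiteQ m n (x%:A + y *: I) =
  (2^-1 *: I) ^+ (m + n) * (m`! * n`!)%:R *
  \sum_(k < m.+1) \sum_(j < n.+1)
    ((-1) ^+ (n + k) / (k`! * j`! * (m - k)`! * (n - j)`!)%:R) *:
      (I ^+ (k + j) *
       (hermite (k + j) x * hermite (m + n - k - j) y)%:A).
Proof.
have {}hI : I ^+ 2 = -1 by exact: hI.
pose i : R[i] := Complex 0 1.
pose a k : R[i] := (hermite k x)%:C%C; pose b k : R[i] := (hermite k y)%:C%C.
have hermC t : hermite_rec t%:C%C (fun k => (hermite k t)%:C%C : R[i]).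
  by move=> k; rewrite hermite_recP rmorphB !rmorphM !rmorph_nat.
have hermC0 t : (hermite 0 t)%:C%C = 1 :> R[i] by rewrite hermite0.
have := umbral2_complex_hermite m n (sqr_imag R) (hermC x) (hermC y)
  (hermC0 x) (hermC0 y).
rewrite umbral2_expansion => umbralE2.
have two_neq0 : (2 : R[i]) != 0 by rewrite pnatr_eq0.
(* Both sides are images of complex numbers under the slice morphism. *)
have -> : 2^-1 *: I = slice hI ((2^-1)%:C%C * i) by rewrite sliceZ slice_i.
have -> : \sum_(k < m.+1) \sum_(j < n.+1)
    ((-1) ^+ (n + k) / (k`! * j`! * (m - k)`! * (n - j)`!)%:R) *:
      (I ^+ (k + j) *
       (hermite (k + j) x * hermite (m + n - k - j) y)%:A) =
  slice hI (\sum_(k < m.+1) \sum_(j < n.+1)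
    ((-1) ^+ (n + k) / (k`! * j`! * (m - k)`! * (n - j)`!)%:R) *
      (i ^+ (k + j) * (a (k + j)%N * b (m + n - k - j)%N))).
  rewrite rmorph_sum; apply: eq_bigr => k _.
  rewrite rmorph_sum; apply: eq_bigr => j _.
  have -> : (-1) ^+ (n + k) / (k`! * j`! * (m - k)`! * (n - j)`!)%:R =
      ((-1) ^+ (n + k) / (k`! * j`! * (m - k)`! * (n - j)`!)%:R)%:C%C :> R[i].
    by rewrite [RHS]rmorphM fmorphV rmorph_nat rmorphXn rmorphN1.
  rewrite /= sliceZ; congr (_ *: _).
  by rewrite (rmorphM (slice hI)) rmorphXn /= slice_i -rmorphM /= slice_real.
rewrite -(rmorph_nat (slice hI)) -rmorphXn -!rmorphM hermiteQ_slice.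
congr (slice hI _); apply: (mulfI (expf_neq0 (m + n) two_neq0)).
(* The factor [2 ^ (m + n)] cancels the halves in [(i / 2) ^ (m + n)]; the two
   double sums then agree term by term. *)
rewrite -umbralE2 mulrA [2 ^+ _ * _]mulrA -exprMn mulrA fmorphV rmorph_nat.
rewrite mulfV // mul1r.
rewrite !mulr_sumr; apply: eq_bigr => k _.
rewrite !mulr_sumr; apply: eq_bigr => j _.
have km : (k <= m)%N by rewrite -ltnS.
have jn : (j <= n)%N by rewrite -ltnS.
rewrite !expr_subn_sqrtN1 ?sqrrN ?sqr_imag//.
have -> : (m`! * n`!)%:R = ('C(m, k) * 'C(n, j))%:R *
    (k`! * j`! * (m - k)`! * (n - j)`!)%:R :> R[i].
  by rewrite -natrM -(bin_fact km) -(bin_fact jn); congr (_%:R); lia.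
set D := (k`! * _ * _ * _)%:R.
have D0 : D != 0 by rewrite pnatr_eq0 -lt0n !muln_gt0 !fact_gt0.
have signE : (-1) ^+ j * (-1) ^+ (n + j) = (-1) ^+ n :> R[i].
  by rewrite exprD mulrCA -expr2 sqrr_sign mulr1.
rewrite -/i [(- i) ^+ _]exprNn [(-1) ^+ j * (_ * _)]mulrA signE !exprD /a /b.
by move: D D0 => D D0; field.
Qed.
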